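(* Let $R$ be a simply-connected region in the plane and let $v,w$ be vertices in the interior of $R$, such that there is a path of $m$ vertices from $v$ to $w$, staying entirely within $R$. Then, for all $c>0$, the probability that $H(v)-H(w)$ (under the uniform distribution on domino tilings of $R$) differs from its expected value by more than $c\sqrt m$ is less than $2e^{-c^2/32}$.
   Context: A region is a finite union of unit squares of the square lattice that can be tiled by dominos, with a fixed checkerboard coloring of the lattice squares. A path is a lattice path: a sequence of vertices with consecutive ones joined by an edge of a lattice square of $R$. A height function on $R$ is an integer-valued function $h$ on the vertices of the lattice squares of $R$ such that, for adjacent vertices $u,u'$: if the edge $uu'$ is part of the boundary of $R$ then $|h(u)-h(u')|=1$, and if the directed edge from $u$ to $u'$ has a black square on its left then $h(u')$ is either $h(u)+1$ or $h(u)-3$. Each domino tiling of $R$ arises from a height function (the dominos being those bisected by the edges $uu'$ with $|h(u)-h(u')|=3$), unique up to an additive constant; fixing the height of one boundary vertex makes this a bijection. $H$ denotes the height function of a uniformly random domino tiling of $R$ (the difference $H(v)-H(w)$ does not depend on the additive constant). *)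

(* Defs.v *)
From HB Require Import structures.
From mathcomp Require Export all_boot all_order all_algebra finmap.
From mathcomp Require Export all_classical all_reals all_analysis.
Export Order.TTheory GRing.Theory Num.Theory.
Export numFieldNormedType.Exports.

Set Implicit Arguments.
Unset Strict Implicit.
Unset Printing Implicit Defensive.

Local Open Scope classical_set_scope.
Local Open Scope ring_scope.

(* [F (t, s)] is the value at time [t] of the loop at stage [s]; all stages
   are based at [g 0]. *)
Section SimplyConnected.
Variables (K : realType) (X : topologicalType).
Implicit Types (A : set X) (g : K -> X).

Definition path_connected_set A : Prop :=
  A !=set0 /\
  forall x y, A x -> A y ->
    exists g : K -> X, [/\ {within `[0, 1]%classic, continuous g},
      g @` `[0, 1]%classic `<=` A, g 0 = x & g 1 = y].

Definition null_homotopic_in A g : Prop :=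
  exists F : K * K -> X,
    [/\ {within `[0, 1]%classic `*` `[0, 1]%classic, continuous F},
        F @` (`[0, 1]%classic `*` `[0, 1]%classic) `<=` A,
        forall t : K, 0 <= t <= 1 -> F (t, 0) = g t /\ F (t, 1) = g 0 &
        forall s : K, 0 <= s <= 1 -> F (0, s) = g 0 /\ F (1, s) = g 0].

Definition simply_connected A : Prop :=
  path_connected_set A /\
  forall g : K -> X, {within `[0, 1]%classic, continuous g} ->
    g @` `[0, 1]%classic `<=` A -> g 0 = g 1 -> null_homotopic_in A g.

End SimplyConnected.
Arguments simply_connected K {X} A.

(* The square [(i, j)] is [i, i + 1] x [j, j + 1]. *)
Notation square := (int * int)%type (only parsing).
Notation vertex := (int * int)%type (only parsing).

Definition vertex_point (K : realType) (u : vertex) : K * K :=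
  (u.1%:~R, u.2%:~R).

Definition square_set (K : realType) (s : square) : set (K * K) :=
  `[s.1%:~R, s.1%:~R + 1]%classic `*` `[s.2%:~R, s.2%:~R + 1]%classic.
Arguments square_set K s : clear implicits.

Definition region_set (K : realType) (R : {fset square}) : set (K * K) :=
  \bigcup_(s in [set` R]) square_set K s.
Arguments region_set K R : clear implicits.

(* In counterclockwise order. *)
Definition corners (s : square) : seq vertex :=
  [:: s; (s.1 + 1, s.2); (s.1 + 1, s.2 + 1); (s.1, s.2 + 1)].

Definition left_of (s : square) (u u' : vertex) : bool :=
  (u \in corners s) && (next (corners s) u == u').

Definition edge_of (s : square) (u u' : vertex) : bool :=
  left_of s u u' || left_of s u' u.

Definition adjacent_squares (s t : square) : bool :=
  `|s.1 - t.1| + `|s.2 - t.2| == 1.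

Definition checkerboard (black : pred square) : Prop :=
  forall s t, adjacent_squares s t -> black s = ~~ black t.

Definition adjacent (R : {fset square}) : rel vertex :=
  fun u u' => [exists s : R, edge_of (val s) u u'].

Definition boundary_edge (R : {fset square}) (u u' : vertex) : Prop :=
  exists s t, [/\ s \in R, edge_of s u u', t \notin R & edge_of t u u'].

Definition domino (d : {fset square}) : Prop :=
  exists s t, adjacent_squares s t /\ d = [fset s; t]%fset.

Definition tiling (R : {fset square}) (T : {fset {fset square}}) : Prop :=
  [/\ forall d, d \in T -> domino d, trivIfset T & fcover T = R].

Definition tilings (R : {fset square}) : {fset {fset {fset square}}} :=
  [fset T in fpowerset (fpowerset R) | `[< tiling R T >]]%fset.

(* The square to the left of [u u'] need not belong to [R]; only the values
   of [h] at the vertices of the squares of [R] are constrained. *)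
Definition height_function (black : pred square) (R : {fset square})
    (h : vertex -> int) : Prop :=
  forall u u', adjacent R u u' ->
    (boundary_edge R u u' -> `|h u - h u'| = 1) /\
    ((exists2 s, black s & left_of s u u') ->
       h u' = h u + 1 \/ h u' = h u - 3).

Definition arises_from (R : {fset square}) (T : {fset {fset square}})
    (h : vertex -> int) : Prop :=
  forall d, d \in T <->
    exists u u' s t, [/\ adjacent R u u', `|h u - h u'| = 3,
      left_of s u u', left_of t u' u & d = [fset s; t]%fset].

(* The choice fixes the additive constant separately for each tiling, so only
   differences of heights at vertices of [R] are meaningful. *)
Definition height (black : pred square) (R : {fset square})
    (T : {fset {fset square}}) : vertex -> int :=
  xget (fun=> 0) [set h | height_function black R h /\ arises_from R T h].

Section Uniform.
Variables (K : realType) (R : {fset square}).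

Definition tiling_prob (E : pred {fset {fset square}}) : K :=
  #|` [fset T in tilings R | E T]%fset |%:R / #|` tilings R|%:R.

Definition tiling_mean (f : {fset {fset square}} -> K) : K :=
  (\sum_(T <- tilings R) f T) / #|` tilings R|%:R.

End Uniform.
Arguments tiling_prob K R E : clear implicits.
Arguments tiling_mean {K} R f.

(* Main.v *)
(* Two tilings T, T' of R differ by a discrete 1-form on the edges of R that
   vanishes on the boundary edges.  Extended by 0 it is curl-free on all of Z^2,
   so it has a primitive there: a quarter of the difference of the two height
   functions.  Hence, relative to a reference tiling T0, every tiling has a
   potential psi on Z^2 with psi v = 0, and either all tilings of R have height
   functions or none has (then [height] is 0); the topology of R plays no role.

   The potential at w is exposed vertex by vertex along the path from v.  Each
   step has two possible outcomes, differing by 1, and the conditional means of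
   psi w given these outcomes differ by at most 1: otherwise, exchange two
   tilings on the connected component of w in the set where the shifted
   potentials disagree.  This sign-reversing exchange replaces the FKG
   inequality.  Azuma's inequality over the m - 1 steps gives the bound, strictly
   since m - 1 < m. *)

Require Import Defs.
From mathcomp Require Import ring lra zify.

Set Implicit Arguments.
Unset Strict Implicit.
Unset Printing Implicit Defensive.

Local Open Scope classical_set_scope.
Local Open Scope ring_scope.

(** * Azuma's inequality for integer heights on a finite set *)

Section Analysis.
Variable K : realType.
Implicit Types x y : K.

Lemma nondecreasing_of_derive (f df : K -> K) :
  (forall x, is_derive x 1 f (df x)) -> (forall x, 0 <= x -> 0 <= df x) ->
  forall x, 0 <= x -> f 0 <= f x.
Proof.
move=> fdf df0 x x0.
have fd y : derivable f y 1 by case: (fdf y).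
have fc y : {for y, continuous f}.
  by apply/differentiable_continuous/derivable1_diffP.
apply: (@ger0_derive1_ndecr K f 0 x) => //.
- move=> y; rewrite in_itv /= => /andP[y0 _].
  by rewrite derive1E; case: (fdf y) => _ ->; rewrite df0 // ltW.
- exact: continuous_subspaceT.
Qed.

(** The difference of the two sides vanishes at 0 and has derivative [x * (expR x - expR (- x))],
    which is nonnegative for [x >= 0]. *)
Lemma sinh_le x : 0 <= x ->
  expR x - expR (- x) <= x * (expR x + expR (- x)).
Proof.
move=> x0.
pose s y := y * (expR y + expR (- y)) - (expR y - expR (- y)).
have ds y : is_derive y 1 s (y * (expR y - expR (- y))).
  apply: is_derive_eq; rewrite /GRing.scale /=; ring.
rewrite -subr_ge0; have := nondecreasing_of_derive ds _ x0.
rewrite /s oppr0 expR0 mul0r subrr subr0; apply=> y y0.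
by rewrite mulr_ge0 // subr_ge0 ler_expR ge0_cp.
Qed.

(** Both sides are even. For [x >= 0] the quotient of [expR x + expR (- x)] by [expR (x ^+ 2 / 2)]
    is nonincreasing, by [sinh_le], and equals 2 at 0. *)
Lemma cosh_le x : expR x + expR (- x) <= 2 * expR (x ^+ 2 / 2).
Proof.
wlog x0 : x / 0 <= x.
  move=> H; have [/H//|x0] := leP 0 x.
  by have := H (- x); rewrite opprK sqrrN addrC oppr_ge0; apply; exact: ltW.
pose g y := - (expR (- (y ^+ 2 / 2)) * (expR y + expR (- y))).
have dg y : is_derive y 1 g (expR (- (y ^+ 2 / 2)) *
    (y * (expR y + expR (- y)) - (expR y - expR (- y)))).
  by apply: is_derive_eq; rewrite /GRing.scale /=; field.
have := nondecreasing_of_derive dg _ x0.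
rewrite /g expr0n /= mul0r !oppr0 expR0 lerNl opprK mul1r => H.
have {}H : expR (- (x ^+ 2 / 2)) * (expR x + expR (- x)) <= 1 + 1.
  apply: H => y y0; rewrite mulr_ge0 ?expR_ge0// subr_ge0; exact: sinh_le.
by rewrite -ler_pdivrMr ?expR_gt0// -expRN mulrC.
Qed.

(** Hoeffding's estimate for the centered variable with value [(1 - q) * d] with probability [q] and
    [- q * d] otherwise. Both values lie in [-1, 1], where the exponential is below its chord. *)
Lemma two_point_mgf (q d l : K) : 0 <= q <= 1 -> `|d| <= 1 ->
  q * expR (l * ((1 - q) * d)) + (1 - q) * expR (l * (- q * d))
    <= expR (l ^+ 2 / 2).
Proof.
move=> /andP[q0 q1] d1.
have chord y : `|y| <= 1 ->
    expR (l * y) <= (1 + y) / 2 * expR l + (1 - y) / 2 * expR (- l).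
  rewrite ler_norml => /andP[y0 y1].
  have t01 : 0 <= (1 + y) / 2 <= 1 by apply/andP; split; lra.
  have /andP[t0 t1] := t01.
  have := convex_expR (Itv01 t0 t1) l (- l).
  rewrite !convRE /= /unstable.onem.
  rewrite [X in expR X <= _](_ : _ = l * y); last by field.
  by rewrite [X in _ + X * _](_ : _ = (1 - y) / 2) //; field.
have b0 : `|(1 - q) * d| <= 1.
  by rewrite normrM (ger0_norm (_ : 0 <= 1 - q)) ?subr_ge0// mulr_ile1
    ?normr_ge0 ?subr_ge0 ?gerBl.
have b1 : `|- q * d| <= 1.
  by rewrite normrM normrN (ger0_norm q0) mulr_ile1.
have c := cosh_le l.
have e0 := chord _ b0; have e1 := chord _ b1.
have {}e0 := ler_wpM2l q0 e0.
have q1' : 0 <= 1 - q by rewrite subr_ge0.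
have {}e1 := ler_wpM2l q1' e1.
apply: le_trans (lerD e0 e1) _.
(* The variable has mean zero, so the linear parts of the two chords cancel. *)
rewrite [leLHS](_ : _ = (expR l + expR (- l)) / 2); last by field.
by rewrite ler_pdivrMr // mulrC.
Qed.
End Analysis.

(** * Conditional means under successive exposure, and the tail bound *)

Section BoundedDifferences.
Variables (K : realType) (X : finType) (V : eqType) (val : X -> V -> int).
Variables (v w : V).

Definition cylinder (S : seq V) (a : V -> int) : {set X} :=
  [set T | all (fun u => val T u == a u) S].

Definition mean (A : {set X}) : K :=
  (\sum_(T in A) (val T w)%:~R) / #|A|%:R.

(* Monotonicity of conditional means, cleared of denominators. *)
Hypothesis swap_le : forall S (a b : V -> int) (k : int),
  v \in S -> (forall u, u \in S -> a u <= b u + k) ->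
  \sum_(T in cylinder S a) \sum_(T' in cylinder S b)
    (val T w - val T' w - k) <= 0.

(** The double sum in [swap_le], divided by the sizes of the two nonempty cylinders, is the
    difference of the conditional means minus [k]. *)
Lemma mean_le S a b k : v \in S -> (forall u, u \in S -> a u <= b u + k) ->
  cylinder S a != finset.set0 -> cylinder S b != finset.set0 ->
  mean (cylinder S a) <= mean (cylinder S b) + k%:~R.
Proof.
move=> vS ab; rewrite -!card_gt0 => A0 B0.
have := swap_le vS ab; move: A0 B0.
rewrite /mean; set A := cylinder S a; set B := cylinder S b => A0 B0 H.
have {}A0 : 0 < #|A|%:R :> K by rewrite ltr0n.
have {}B0 : 0 < #|B|%:R :> K by rewrite ltr0n.
have : (\sum_(T in A) \sum_(T' in B) (val T w - val T' w - k))%:~R <= 0 :> K.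
  by rewrite lerz0.
set s : K := \sum_(T in A) (val T w)%:~R; set t : K := \sum_(T in B) _.
have -> : (\sum_(T in A) \sum_(T' in B) (val T w - val T' w - k))%:~R =
    s * #|B|%:R - t * #|A|%:R - k%:~R * #|B|%:R * #|A|%:R :> K.
  rewrite raddf_sum /= /s mulr_suml !mulr_natr -!sumr_const -!sumrB.
  apply: eq_bigr => T _; rewrite raddf_sum /= mulr_sumr /t -!sumrB.
  by apply: eq_bigr => T' _; rewrite !intrB mulr1.
move=> {}H.
rewrite ler_pdivrMr // mulrDl -mulrA (mulrC _^-1) mulrA -subr_ge0.
rewrite -(pmulr_lge0 _ B0) mulrBl mulrDl divfK ?gt_eqF//.
by move: H; set x := s * _; lra.
Qed.

(** The offset [e] is the same for all [T]: once the value at [x] is known, the value at [y] is one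
    of two fixed consecutive integers. *)
Definition two_valued_step : rel V := fun x y =>
  `[< exists e : int, forall T, (val T y == val T x + e)
                             || (val T y == val T x + e + 1) >].

(** Induction along the path. [S] holds the exposed vertices, [x] is the last one reached, and
    exposing the next vertex costs at most a factor [expR (l ^+ 2 / 2)] by [two_point_mgf]. *)
Lemma azuma_mgf (l : K) p : forall S a x, v \in S -> x \in S ->
  path two_valued_step x p -> last x p = w ->
  let A := cylinder S a in
  \sum_(T in A) expR (l * ((val T w)%:~R - mean A))
    <= #|A|%:R * expR (l ^+ 2 / 2 * (size p)%:R).
Proof.
elim: p => [|y p IH] S a x vS xS /=.
  move=> _ xw; rewrite mulr0 expR0 mulr1; set A := cylinder S a.
  have Aw T : T \in A -> val T w = a w.
    by rewrite inE => /allP/(_ _ xS)/eqP; rewrite xw.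
  have [->|A0] := eqVneq A finset.set0; first by rewrite big_set0 cards0.
  have cA : #|A|%:R != 0 :> K by rewrite pnatr_eq0 cards_eq0.
  have mA : mean A = (a w)%:~R.
    rewrite /mean (eq_bigr (fun=> (a w)%:~R)) => [|T /Aw->//].
    by rewrite sumr_const -[X in X / _]mulr_natr mulfK.
  rewrite (eq_bigr (fun=> 1)) ?sumr_const // => T /Aw ->.
  by rewrite mA subrr mulr0 expR0.
move=> /andP[/asboolP[e he] yp] lw; set A := cylinder S a.
(* A step that reveals nothing is charged all the same, which only weakens the bound. *)
have le_size (s : K) : s <= #|A|%:R * expR (l ^+ 2 / 2 * (size p)%:R) ->
    s <= #|A|%:R * expR (l ^+ 2 / 2 * (size p).+1%:R).
  move/le_trans; apply; rewrite ler_wpM2l// ler_expR ler_wpM2l ?ler_nat//.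
  by rewrite divr_ge0// sqr_ge0.
(* The path may return to a vertex whose value is already known. *)
have [yS|yS] := boolP (y \in S); first exact/le_size/(IH S a y).
pose b i : V -> int := fun u => if u == y then a x + e + i else a u.
pose B i := cylinder (y :: S) (b i).
have BE i T : (T \in B i) = (T \in A) && (val T y == a x + e + i).
  rewrite !inE /= {1}/b eqxx andbC; congr andb.
  by apply: eq_in_all => u uS; rewrite /b; case: (u =P y) => // uy; rewrite -uy uS in yS.
have ABE T : T \in A -> (val T y == a x + e + 1) = ~~ (val T y == a x + e + 0).
  rewrite inE => /allP/(_ _ xS)/eqP TA; have := he T; rewrite TA addr0.
  by case: eqP => /=[->|_ ->]//; rewrite -subr_eq0 opprD addrA subrr.
have split (F : X -> K) :
    \sum_(T in A) F T = \sum_(T in B 0) F T + \sum_(T in B 1) F T.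
  rewrite (bigID (fun T => val T y == a x + e + 0)) /=; congr (_ + _).
    by apply: eq_bigl => T; rewrite BE.
  by apply: eq_bigl => T; rewrite BE; case: (boolP (T \in A)) => //= /ABE ->.
have cardA : #|A|%:R = #|B 0|%:R + #|B 1|%:R :> K.
  by have := split (fun=> 1); rewrite !sumr_const.
have vyS : v \in y :: S by rewrite inE vS orbT.
have IHB i := IH (y :: S) (b i) y vyS (mem_head _ _) yp lw.
(* If one outcome at [y] is impossible, the other cylinder is all of [A]. *)
have [B00|B00] := eqVneq (B 0) finset.set0.
  have AB : A = B 1.
    apply/setP => T; rewrite BE; case: (boolP (T \in A)) => //= TA.
    rewrite ABE //; apply/esym; have := finset.in_set0 T.
    by rewrite -B00 BE TA /= => ->.
  by apply: le_size; rewrite AB; exact: IHB.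
have [B10|B10] := eqVneq (B 1) finset.set0.
  have AB : A = B 0.
    apply/setP => T; rewrite BE; case: (boolP (T \in A)) => //= TA.
    apply/esym; have := finset.in_set0 T; rewrite -B10 BE TA /= ABE //.
    by move/negbFE.
  by apply: le_size; rewrite AB; exact: IHB.
have c0 : 0 < #|B 0|%:R :> K by rewrite ltr0n card_gt0.
have c1 : 0 < #|B 1|%:R :> K by rewrite ltr0n card_gt0.
have cA : 0 < #|A|%:R :> K by rewrite cardA addr_gt0.
(* [q] is the conditional probability of the higher outcome, and [d] is the gap between the two
   conditional means. The martingale increments are then those of [two_point_mgf]. *)
set q : K := #|B 1|%:R / #|A|%:R; set d := mean (B 1) - mean (B 0).
have mA : mean A * #|A|%:R = mean (B 0) * #|B 0|%:R + mean (B 1) * #|B 1|%:R.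
  by rewrite /mean !divfK ?gt_eqF// split.
have qA : q * #|A|%:R = #|B 1|%:R by rewrite /q divfK ?gt_eqF.
have m1 : mean (B 1) - mean A = (1 - q) * d.
  apply: (mulIf (lt0r_neq0 cA)); rewrite mulrBl mA.
  rewrite (_ : _ * d * _ = d * (#|A|%:R - q * #|A|%:R)); last by ring.
  by rewrite qA cardA /d; ring.
have m0 : mean (B 0) - mean A = - q * d.
  apply: (mulIf (lt0r_neq0 cA)); rewrite mulrBl mA.
  rewrite (_ : - q * d * _ = - d * (q * #|A|%:R)); last by ring.
  by rewrite qA cardA /d; ring.
(* The prescriptions satisfy [b 0 <= b 1] and [b 1 <= b 0 + 1], so [mean_le] with shifts 0 and 1
   gives [0 <= d <= 1]. *)
have d1 : `|d| <= 1.
  rewrite /d ler_norml lerBlDl lerBrDl.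
  have := @mean_le (y :: S) (b 0) (b 1) 0 vyS _ B00 B10.
  have := @mean_le (y :: S) (b 1) (b 0) 1 vyS _ B10 B00.
  rewrite -/(B 0) -/(B 1) => h1 h2.
  have {}h1 : mean (B 1) <= mean (B 0) + 1.
    by apply: h1 => u _; rewrite /b; case: ifP => _; lia.
  have {}h2 : mean (B 0) <= mean (B 1) + 0.
    by apply: h2 => u _; rewrite /b; case: ifP => _; lia.
  by apply/andP; split; lra.
have q01 : 0 <= q <= 1.
  by rewrite divr_ge0 ?ler0n//= ler_pdivrMr// mul1r cardA lerDr.
have part i : \sum_(T in B i) expR (l * ((val T w)%:~R - mean A)) <=
    expR (l * (mean (B i) - mean A)) *
    (#|B i|%:R * expR (l ^+ 2 / 2 * (size p)%:R)).
  apply: le_trans (ler_wpM2l (expR_ge0 _) (IHB i)).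
  rewrite mulr_sumr; apply: ler_sum => T _; rewrite -expRD -mulrDr.
  by rewrite [X in _ <= expR (l * X)]addrC subrKA.
rewrite split; apply: le_trans (lerD (part 0) (part 1)) _.
rewrite m0 m1 -[(size p).+1%:R]natr1 (mulrDr (l ^+ 2 / 2)) mulr1 expRD.
have := two_point_mgf l q01 d1; have := expR_ge0 (l ^+ 2 / 2 * (size p)%:R).
have -> : #|B 0|%:R = (1 - q) * #|A|%:R.
  by rewrite mulrBl mul1r qA cardA addrK.
rewrite -qA.
set E := expR _; set f := expR (l * (_ * d)); set g := expR (l * (- q * d)).
set h := expR _ => E0 H.
have := ler_wpM2l (mulr_ge0 (ltW cA) E0) H.
by rewrite /f; lra.
Qed.

Hypothesis val_base : forall T, val T v = 0.

Lemma azuma_tail (p : seq V) (m : nat) (t : K) :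
  path two_valued_step v p -> last v p = w -> (size p < m)%N ->
  (0 < #|X|)%N -> 0 < t ->
  #|[set T | t < `|(val T w)%:~R - mean finset.setT|]%SET|%:R
    < 2 * #|X|%:R * expR (- (t ^+ 2 / (2 * m%:R))).
Proof.
move=> vp lw pm X0 t0.
have m0 : 0 < m%:R :> K by rewrite ltr0n (leq_ltn_trans _ pm).
(* The Chernoff exponent [l ^+ 2 * m / 2 - l * t] is least at [l = t / m]. *)
set mu := mean _; set l := t / m%:R; set r := expR _.
have mgf (s : K) : \sum_T expR (s * ((val T w)%:~R - mu))
    <= #|X|%:R * expR (s ^+ 2 / 2 * (size p)%:R).
  have := azuma_mgf s (fun=> 0) (mem_head v [::]) (mem_head v [::]) vp lw.
  (* All values at [v] are 0, so exposing [v] reveals nothing and the conditional mean is the global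
     one. *)
  suff -> : cylinder [:: v] (fun=> 0) = finset.setT.
    by rewrite /= cardsT (eq_bigl predT) => [|T]; rewrite ?finset.inE.
  by apply/setP => T; rewrite !finset.inE /= val_base eqxx.
(* The signs [s = 1] and [s = -1] give the upper and the lower tail. *)
have one_sided (s : K) : s ^+ 2 = 1 ->
    #|[set T | (t < s * ((val T w)%:~R - mu))%R]%SET|%:R < #|X|%:R * r.
  move=> s2; set E := (E in #|E|).
  have le_mgf : #|E|%:R * expR (l * t) <= #|X|%:R * expR (l ^+ 2 / 2 * (size p)%:R).
    have -> : l ^+ 2 = (l * s) ^+ 2 by rewrite [RHS]exprMn s2 mulr1.
    apply: le_trans (mgf (l * s)).
    rewrite mulr_natl -sumr_const big_mkcond /=; apply: ler_sum => T _.
    case: ifP => [|_]; last exact: expR_ge0.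
    rewrite finset.inE ler_expR -mulrA => /ltW ?.
    by rewrite ler_wpM2l // divr_ge0 ?ltW.
  rewrite -(ltr_pM2r (expR_gt0 (l * t))); apply: le_lt_trans le_mgf _.
  rewrite -[ltRHS]mulrA ltr_pM2l ?ltr0n // -expRD ltr_expR /l.
  rewrite [ltRHS](_ : _ = (t / m%:R) ^+ 2 / 2 * m%:R); last first.
    by field; rewrite gt_eqF.
  (* Strictness comes from [size p < m]. *)
  by rewrite ltr_pM2l ?ltr_nat// divr_gt0// exprn_gt0// divr_gt0.
have := one_sided 1 (expr1n _ _); have := one_sided (-1).
rewrite sqrrN expr1n => /(_ erefl) hN hP.
rewrite -mulrA mulr_natl mulr2n; apply: le_lt_trans (ltrD hP hN).
rewrite -natrD ler_nat; apply: leq_trans (leq_card_setU _ _).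
apply: subset_leq_card; apply/fintype.subsetP => T; rewrite !finset.inE.
by rewrite mul1r mulN1r ltr_normr.
Qed.

End BoundedDifferences.

(** * Tilings and potentials on the square lattice *)

Notation tilings_type := {fset {fset int * int}} (only parsing).

Definition east (u : int * int) := (u.1 + 1, u.2).
Definition west (u : int * int) := (u.1 - 1, u.2).
Definition north (u : int * int) := (u.1, u.2 + 1).
Definition south (u : int * int) := (u.1, u.2 - 1).

(* [hdom u] and [vdom u] are the dominos bisected by the edges from [u] to
   [east u] and to [north u]. *)
Definition hdom (u : int * int) : {fset int * int} := [fset u; south u]%fset.
Definition vdom (u : int * int) : {fset int * int} := [fset west u; u]%fset.

Lemma westK : cancel west east.
Proof. by case=> a b; congr pair => /=; ring. Qed.
Lemma eastK : cancel east west.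
Proof. by case=> a b; congr pair => /=; ring. Qed.
Lemma southK : cancel south north.
Proof. by case=> a b; congr pair => /=; ring. Qed.
Lemma northK : cancel north south.
Proof. by case=> a b; congr pair => /=; ring. Qed.

Lemma pair_eqE (u u' : int * int) : (u == u') = (u.1 == u'.1) && (u.2 == u'.2).
Proof. by case: u u' => [a b] [a' b']. Qed.

Lemma adjacent_squaresP s t :
  reflect [\/ t = east s, t = west s, t = north s | t = south s]
          (adjacent_squares s t).
Proof.
rewrite /adjacent_squares; case: s t => [a b] [a' b'] /=.
apply: (iffP eqP) => [H|[] [-> ->] /=]; try lia.
rewrite /east /west /north /south /=.
have [[-> ->]|[[-> ->]|[[-> ->]|[-> ->]]]] : ((a' = a + 1) /\ (b' = b)) \/
  ((a' = a - 1) /\ (b' = b)) \/ ((a' = a) /\ (b' = b + 1)) \/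
  ((a' = a) /\ (b' = b - 1)) by lia.
all: by [exact: Or41 | exact: Or42 | exact: Or43 | exact: Or44].
Qed.

Lemma dominoP d : domino d <-> exists u, d = hdom u \/ d = vdom u.
Proof.
split=> [[s [t [/adjacent_squaresP st ->]]]|[u [->|->]]].
- case: st => ->.
  + by exists (east s); right; rewrite /vdom eastK.
  + by exists s; right; rewrite /vdom fsetUC.
  + by exists (north s); left; rewrite /hdom northK fsetUC.
  + by exists s; left.
- by exists u, (south u); split=> //; apply/adjacent_squaresP/Or44.
- exists (west u), u; split=> //; apply/adjacent_squaresP/Or41.
  by rewrite westK.
Qed.

Lemma mem_hdom s u : (s \in hdom u) = (u == s) || (u == north s).
Proof.
by rewrite !inE !pair_eqE /=; apply/idP/idP; lia.
Qed.

Lemma mem_vdom s u : (s \in vdom u) = (u == s) || (u == east s).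
Proof.
by rewrite !inE !pair_eqE /=; apply/idP/idP; lia.
Qed.

Lemma hdom_inj : injective hdom.
Proof.
move=> u u' e; have := mem_hdom u u; have := mem_hdom (south u) u.
have := mem_hdom u u'; have := mem_hdom (south u) u'.
rewrite -e southK !mem_hdom southK !eqxx ?orbT; case: u u' e => [a b] [a' b'] _.
by rewrite !pair_eqE /= => *; congr pair; lia.
Qed.

Lemma vdom_inj : injective vdom.
Proof.
move=> u u' e.
have := mem_vdom u u'; have := mem_vdom (west u) u'.
rewrite -e westK !mem_vdom westK !eqxx ?orbT; case: u u' e => [a b] [a' b'] _.
by rewrite !pair_eqE /= => *; congr pair; lia.
Qed.

Lemma hdom_neq_vdom u u' : hdom u != vdom u'.
Proof.
apply/eqP => e; have := mem_vdom u u'; have := mem_vdom (south u) u'.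
rewrite -e !mem_hdom southK !eqxx ?orbT !pair_eqE /= => *; lia.
Qed.

(** Integer-valued indicators make the covering condition of a tiling linear. *)
Definition xh (T : tilings_type) u : int := Posz (hdom u \in T).
Definition xv (T : tilings_type) u : int := Posz (vdom u \in T).

Definition cover_count (T : tilings_type) s : int :=
  xh T s + xh T (north s) + xv T s + xv T (east s).

Lemma mem_domino_at (T : tilings_type) d s :
  (forall d, d \in T -> domino d) -> d \in T -> s \in d ->
  [\/ d = hdom s, d = hdom (north s), d = vdom s | d = vdom (east s)].
Proof.
move=> Td /Td/dominoP[u [->|->]]; rewrite ?mem_hdom ?mem_vdom => /orP[]/eqP->.
- exact: Or41.
- exact: Or42.
- exact: Or43.
- exact: Or44.
Qed.

Lemma mem_fcover (I : choiceType) (P : {fset {fset I}}) x :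
  reflect (exists2 B, B \in P & x \in B) (x \in fcover P).
Proof.
apply: (iffP (bigfcupP _ _ _ _)) => [[B /andP[BP _] xB]|[B BP xB]]; exists B => //.
by rewrite BP.
Qed.

(** Exactly four distinct dominos contain a given square, those listed in [N]. Disjointness and
    covering together say that [T] has one of them if the square is in [R] and none otherwise. *)
Lemma tilingP (R : {fset int * int}) (T : tilings_type) :
  tiling R T <-> (forall d, d \in T -> domino d) /\
                 (forall s, cover_count T s = Posz (s \in R)).
Proof.
pose N s := [:: hdom s; hdom (north s); vdom s; vdom (east s)].
have sN s d : d \in N s -> s \in d.
  by rewrite !inE => /or4P[] /eqP ->; rewrite ?mem_hdom ?mem_vdom eqxx ?orbT.
have NN s : uniq (N s).
  rewrite /N /= !inE !negb_or !hdom_neq_vdom (inj_eq hdom_inj) (inj_eq vdom_inj).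
  by rewrite !pair_eqE /= => *; lia.
have countE s : cover_count T s = Posz (count (mem T) (N s)).
  by rewrite /cover_count /xh /xv /= !PoszD addr0 !addrA.
split=> [[Td /trivIfsetP Tt TR]|[Td cT]].
  split=> // s; rewrite countE -TR; congr Posz.
  case: mem_fcover => [[d dT sd]|nd].
    have dN : d \in N s.
      by case: (mem_domino_at Td dT sd) => ->; rewrite !inE eqxx ?orbT.
    rewrite (@eq_in_count _ _ (pred1 d)) ?count_uniq_mem ?dN// => d' d'N /=.
    have [->|dd'] := eqVneq d' d; first exact: dT.
    apply/negbTE/negP => d'T; have /fdisjointP/(_ _ (sN _ _ d'N)) := Tt _ _ d'T dT dd'.
    by rewrite sd.
  apply/eqP; rewrite -leqn0 leqNgt -has_count; apply/hasPn => d dN.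
  by apply/negP => dT; apply: nd; exists d => //; exact: sN.
have {cT} TR s : count (mem T) (N s) = (s \in R).
  by have := esym (countE s); rewrite cT; case.
split=> //.
  apply/trivIfsetP => d d' dT d'T; apply: contraNT => /fset0Pn[s].
  rewrite inE => /andP[sd sd'].
  have mN e : e \in T -> s \in e -> e \in N s.
    by move=> eT se; case: (mem_domino_at Td eT se) => ->; rewrite !inE eqxx ?orbT.
  have : (size (seq.filter (mem T) (N s)) <= 1)%N by rewrite size_filter TR leq_b1.
  have : d \in seq.filter (mem T) (N s) by rewrite mem_filter /= dT mN.
  have : d' \in seq.filter (mem T) (N s) by rewrite mem_filter /= d'T mN.
  by case: seq.filter => [|e [|]] //=; rewrite !inE => /eqP-> /eqP->.
apply/fsetP => s; have := TR s.
case: mem_fcover => [[d dT sd]|nd].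
  case: (s \in R) => // c0; have : d \in N s.
    by case: (mem_domino_at Td dT sd) => ->; rewrite !inE eqxx ?orbT.
  move=> dN; have : has (mem T) (N s) by apply/hasP; exists d.
  by rewrite has_count c0.
case: (s \in R) => // c1; have : has (mem T) (N s) by rewrite has_count c1.
by move=> /hasP[d dN dT]; case: nd; exists d => //; exact: sN.
Qed.

(** * Discrete primitives on the square lattice *)

Lemma int_primitive (f : int -> int) :
  exists F : int -> int, F 0 = 0 /\ forall n, F (n + 1) = F n + f n.
Proof.
exists (fun n => match n with
  | Posz n => \sum_(i < n) f (Posz i)
  | Negz n => - \sum_(i < n.+1) f (Negz i) end); split; first by rewrite /= big_ord0.
case=> [n|[|n]]; first by rewrite -PoszD addn1 big_ord_recr.
  by rewrite (_ : Negz 0 + 1 = 0) //= big_ord0 big_ord_recl big_ord0 addr0 addNr.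
rewrite (_ : Negz n.+1 + 1 = Negz n); last by rewrite !NegzE; lia.
by rewrite [in RHS]big_ord_recr /= opprD addrNK.
Qed.

Lemma int_const (g : int -> int) : (forall n, g (n + 1) = g n) ->
  forall n, g n = g 0.
Proof.
move=> gS; elim/int_ind => [//|n IH|n IH]; first by rewrite -addn1 PoszD gS.
by rewrite -gS -IH; congr g; rewrite -addn1 PoszD; lia.
Qed.

Lemma grid_const (g : int * int -> int) :
  (forall u, g (east u) = g u) -> (forall u, g (north u) = g u) ->
  forall u v, g u = g v.
Proof.
move=> gE gN; suff H u : g u = g (0, 0) by move=> u v; rewrite !H.
case: u => a b; rewrite (@int_const (fun n => g (n, b))); last first.
  by move=> n; exact: (gE (n, b)).
by rewrite (@int_const (fun n => g (0, n)))// => n; exact: (gN (0, n)).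
Qed.

(** Discrete Poincaré lemma: integrate [fv] along the vertical axis, then [fh] along each row, and
    subtract the value at [v]. *)
Lemma grid_primitive (fh fv : int * int -> int) (v : int * int) :
  (forall u, fh u + fv (east u) = fh (north u) + fv u) ->
  exists f, [/\ f v = 0, forall u, f (east u) = f u + fh u &
                forall u, f (north u) = f u + fv u].
Proof.
move=> curl0.
have [V [V0 VS]] := int_primitive (fun b => fv (0, b)).
pose H b := sval (cid (int_primitive (fun a => fh (a, b)))).
have H0 b : H b 0 = 0 by rewrite /H; case: cid => ? [].
have HS b n : H b (n + 1) = H b n + fh (n, b) by rewrite /H; case: cid => ? [].
pose f u : int := V u.2 + H u.2 u.1.
have fE u : f (east u) = f u + fh u by rewrite /f /= HS addrA -surjective_pairing.
have f0 c : f (0, c) = V c by rewrite /f /= H0 addr0.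
clearbody f.
have fN u : f (north u) = f u + fv u.
  case: u => a b.
  (* The defect of the vertical increment vanishes on the axis and, by [curl0], is constant along
     the row. *)
  have := @int_const (fun n => f (n, b + 1) - f (n, b) - fv (n, b)) _ a.
  rewrite /= !f0 VS => H1.
  have {}H1 : f (north (a, b)) - f (a, b) - fv (a, b) = 0.
    rewrite H1 => [|n]; first by ring.
    change (f (east (north (n, b))) - f (east (n, b)) - fv (east (n, b)) =
      f (north (n, b)) - f (n, b) - fv (n, b)).
    by rewrite !fE; have := curl0 (n, b); lia.
  by lia.
exists (fun u => f u - f v : int); split=> [|u|u]; first by rewrite subrr.
  by rewrite fE; ring.
by rewrite fN; ring.
Qed.

Section Potential.
Variables (black : pred (int * int)) (R : {fset int * int}).
Variables (T0 : tilings_type) (v : int * int).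
Hypotheses (black_ch : checkerboard black) (T0_tiling : tiling R T0).
Implicit Types (T : tilings_type) (u : int * int) (f : int * int -> int).

Definition color_sign u : int := if black u then 1 else -1.

Lemma color_sign_east u : color_sign (east u) = - color_sign u.
Proof.
have/black_ch : adjacent_squares u (east u) by apply/adjacent_squaresP/Or41.
by rewrite /color_sign => ->; case: black.
Qed.

Lemma color_sign_north u : color_sign (north u) = - color_sign u.
Proof.
have/black_ch : adjacent_squares u (north u) by apply/adjacent_squaresP/Or43.
by rewrite /color_sign => ->; case: black.
Qed.

(* Four times [f] is a difference of height functions of [T] and [T0]. *)
Definition potential T f := forall u,
  f (east u) = f u - color_sign u * (xh T u - xh T0 u) /\
  f (north u) = f u + color_sign u * (xv T u - xv T0 u).

(** Sum the increments around square [u]. The alternating sign makes its four dominos enter with the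
    same sign. *)
Lemma potential_curl T f u : potential T f ->
  color_sign u * (cover_count T u - cover_count T0 u) = 0.
Proof.
move=> Tf; rewrite /cover_count.
have [] := Tf u; have [_] := Tf (east u); have [+ _] := Tf (north u).
rewrite color_sign_east color_sign_north (_ : east (north u) = north (east u)) //.
by nia.
Qed.

(** Both tilings cover every square of the plane equally often, so the signed difference of their
    indicators is curl-free. *)
Lemma exists_potential T : tiling R T -> exists f, f v = 0 /\ potential T f.
Proof.
move=> /tilingP[_ TR]; have /tilingP[_ T0R] := T0_tiling.
have [u|f [fv fE fN]] := @grid_primitive (fun u => - (color_sign u * (xh T u - xh T0 u)))
  (fun u => color_sign u * (xv T u - xv T0 u)) v.
  have : cover_count T u = cover_count T0 u by rewrite TR T0R.
  rewrite /cover_count color_sign_east color_sign_north /color_sign; case: black; lia.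
by exists f; split=> // u; rewrite fE fN.
Qed.

(** Converse of [exists_potential]: a potential forces [T] and [T0] to have the same cover
    counts. *)
Lemma tiling_of_potential T f : (forall d, d \in T -> domino d) ->
  potential T f -> tiling R T.
Proof.
move=> Td Tf; apply/tilingP; split=> // s.
have /tilingP[_ <-] := T0_tiling; have := potential_curl s Tf.
by rewrite /color_sign; case: black; lia.
Qed.

Lemma potential_unique T f g : potential T f -> potential T g -> f v = g v ->
  f = g.
Proof.
move=> Tf Tg fgv; apply/funext => u; apply/eqP; rewrite -subr_eq0.
rewrite (@grid_const (fun u => f u - g u) _ _ u v) ?fgv ?subrr// => {}u.
  by have [-> _] := Tf u; have [-> _] := Tg u; ring.
by have [_ ->] := Tf u; have [_ ->] := Tg u; ring.
Qed.

Definition psi T : int * int -> int :=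
  xget (fun=> 0) [set f | f v = 0 /\ potential T f].

Lemma psiP T : tiling R T -> psi T v = 0 /\ potential T (psi T).
Proof. by move=> /exists_potential; exact: xgetPex. Qed.

Lemma psi_unique T f : tiling R T -> f v = 0 -> potential T f -> psi T = f.
Proof.
by move=> /psiP[pv Tp] fv Tf; apply: (potential_unique Tp Tf); rewrite pv fv.
Qed.

(* The common corners of the two squares of a domino are the endpoints of the
   edge that it bisects. *)
Definition touches (C : pred (int * int)) (d : {fset int * int}) : bool :=
  `[< exists2 u, C u & forall s, s \in d -> u \in corners s >].

Lemma touches_hdom C u : touches C (hdom u) = C u || C (east u).
Proof.
apply/asboolP/orP => [[z Cz zd]|Cu].
  have := zd u; have := zd (south u); rewrite !mem_hdom southK !eqxx orbT.
  move=> /(_ isT) + /(_ isT); rewrite !inE !pair_eqE /= => h1 h2.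
  have [zu|zu] : z = u \/ z = east u.
    rewrite [z]surjective_pairing [u]surjective_pairing /east /=.
    have [[-> ->]|[-> ->]] : (z.1 = u.1 /\ z.2 = u.2) \/ (z.1 = u.1 + 1 /\ z.2 = u.2).
      by lia.
    by left.
    by right.
  by left; rewrite -zu.
  by right; rewrite -zu.
case: Cu => Cu; [exists u => //|exists (east u) => //] => s;
  rewrite mem_hdom => /orP[]/eqP->; rewrite !inE !pair_eqE /=; lia.
Qed.

Lemma touches_vdom C u : touches C (vdom u) = C u || C (north u).
Proof.
apply/asboolP/orP => [[z Cz zd]|Cu].
  have := zd u; have := zd (west u); rewrite !mem_vdom westK !eqxx orbT.
  move=> /(_ isT) + /(_ isT); rewrite !inE !pair_eqE /= => h1 h2.
  have [zu|zu] : z = u \/ z = north u.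
    rewrite [z]surjective_pairing [u]surjective_pairing /north /=.
    have [[-> ->]|[-> ->]] : (z.1 = u.1 /\ z.2 = u.2) \/ (z.1 = u.1 /\ z.2 = u.2 + 1).
      by lia.
    by left.
    by right.
  by left; rewrite -zu.
  by right; rewrite -zu.
case: Cu => Cu; [exists u => //|exists (north u) => //] => s;
  rewrite mem_vdom => /orP[]/eqP->; rewrite !inE !pair_eqE /=; lia.
Qed.

Definition swap (C : pred (int * int)) T T' : tilings_type :=
  ([fset d in T | ~~ touches C d] `|` [fset d in T' | touches C d])%fset.

Lemma mem_swap C T T' d :
  (d \in swap C T T') = if touches C d then d \in T' else d \in T.
Proof. by rewrite !inE /=; case: touches; rewrite ?andbT ?andbF ?orbF. Qed.

Lemma swapK C T T' : swap C (swap C T T') (swap C T' T) = T.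
Proof. by apply/fsetP => d; rewrite !mem_swap; case: touches. Qed.

(** [f] vanishes on the outer vertex boundary of [C]. *)
Definition separated (C : pred (int * int)) (f : int * int -> int) :=
  forall u u', adjacent_squares u u' -> C u -> ~~ C u' -> f u' = 0.

(** Gluing: at a vertex outside [C] next to [C] the functions [f] and [g + k] agree. On every edge
    touching [C] both endpoints thus carry [g + k], whose increments belong to [T']. *)
Lemma swap_potential C T T' f g (k : int) : potential T f -> potential T' g ->
  separated C (fun u => f u - g u - k) ->
  potential (swap C T T') (fun u => if C u then g u + k else f u).
Proof.
move=> Tf Tg sep u; rewrite /xh /xv !mem_swap touches_hdom touches_vdom.
have sE := sep u (east u); have sE' := sep (east u) u.
have sN := sep u (north u); have sN' := sep (north u) u.
have aE : adjacent_squares u (east u) by apply/adjacent_squaresP/Or41.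
have aE' : adjacent_squares (east u) u.
  by apply/adjacent_squaresP/Or42; rewrite eastK.
have aN : adjacent_squares u (north u) by apply/adjacent_squaresP/Or43.
have aN' : adjacent_squares (north u) u.
  by apply/adjacent_squaresP/Or44; rewrite northK.
have {}sE := sE aE; have {}sE' := sE' aE'; have {}sN := sN aN.
have {}sN' := sN' aN'.
have [] := Tf u; have [] := Tg u; rewrite /xh /xv => gE gN fE fN.
split.
  case: (C u) sE sE' {sN sN'} => /=; case: (C (east u)) => /= h h'.
  - by rewrite gE; ring.
  - by rewrite -[LHS]subr0 -(h isT isT) gE; ring.
  - by rewrite -[RHS]subr0 -(h' isT isT) gE; ring.
  - by rewrite fE.
case: (C u) sN sN' {sE sE'} => /=; case: (C (north u)) => /= h h'.
- by rewrite gN; ring.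
- by rewrite -[LHS]subr0 -(h isT isT) gN; ring.
- by rewrite -[RHS]subr0 -(h' isT isT) gN; ring.
- by rewrite fN.
Qed.

Lemma swap_tiling C T T' (k : int) : tiling R T -> tiling R T' ->
  separated C (fun u => psi T u - psi T' u - k) -> tiling R (swap C T T').
Proof.
move=> tT tT' sep; have [_ pT] := psiP tT; have [_ pT'] := psiP tT'.
apply: tiling_of_potential (swap_potential pT pT' sep) => d.
case: tT tT' => dT _ _ [dT' _ _].
by rewrite mem_swap; case: ifP => _; [exact: dT'|exact: dT].
Qed.

(** Since [v] is outside [C], the glued potential still vanishes at [v], and uniqueness applies. *)
Lemma psi_swap C T T' (k : int) : tiling R T -> tiling R T' -> ~~ C v ->
  separated C (fun u => psi T u - psi T' u - k) ->
  psi (swap C T T') = (fun u => if C u then psi T' u + k else psi T u).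
Proof.
move=> tT tT' Cv sep; have [pv pT] := psiP tT; have [_ pT'] := psiP tT'.
apply: psi_unique (swap_tiling tT tT' sep) _ (swap_potential pT pT' sep).
by rewrite (negbTE Cv).
Qed.

Lemma separated_opp C f : separated C f -> separated C (fun u => - f u).
Proof. by move=> sep u u' uu' Cu Cu'; rewrite (sep u u') ?oppr0. Qed.

End Potential.

(** * The cluster exchange *)

Lemma mem_tilings R T : reflect (tiling R T) (T \in tilings R).
Proof.
rewrite !inE /=; apply: (iffP andP) => [[_ /asboolP//]|tT].
split; last exact/asboolP.
rewrite fpowersetE; apply/fsubsetP => d dT; rewrite fpowersetE.
case: tT => _ _ <-; apply/fsubsetP => s sd; apply/mem_fcover; by exists d.
Qed.

(** [g] is injective on the positive terms, being undone by itself there, and matches each with an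
    opposite term. The unmatched terms are nonpositive. *)
Lemma sum_le0_of_sign_reversing (P : finType) (Q : pred P) (f : P -> int)
    (g : P -> P) :
  (forall x, Q x -> 0 < f x -> [/\ Q (g x), f (g x) = - f x & g (g x) = x]) ->
  \sum_(x | Q x) f x <= 0.
Proof.
move=> gP; rewrite (bigID (fun x => 0 < f x)) /=.
pose D := [set x | Q x && (0 < f x)]%SET.
have gD x : x \in D -> [/\ Q (g x), f (g x) = - f x & g (g x) = x].
  by rewrite finset.inE => /andP[Qx fx]; exact: gP.
have g_inj : {in D &, injective g}.
  by move=> x y /gD[_ _ gx] /gD[_ _ gy] e; rewrite -gx -gy e.
have -> : \sum_(x | Q x && (0 < f x)) f x = - \sum_(y in g @: D) f y.
  rewrite big_imset //= -sumrN; apply: eq_big => [x|x]; first by rewrite /D finset.inE.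
  by move=> /andP[Qx fx]; have [_ -> _] := gP x Qx fx; rewrite opprK.
rewrite addrC subr_le0 big_mkcond [leRHS]big_mkcond /=; apply: ler_sum => y _.
case: (boolP (y \in g @: D)) => [/imsetP[x xD ->]|_].
  have [-> -> _] := gD _ xD; move: xD; rewrite finset.inE => /andP[_ fx] /=.
  by rewrite -leNgt oppr_le0 (ltW fx).
by case: ifP => // /andP[_]; rewrite -leNgt.
Qed.

(** The connected component of [w] in the set where [f] is nonzero, empty if [f w = 0]. *)
Definition cluster (f : int * int -> int) (w : int * int) : pred (int * int) :=
  fun u => `[< exists p, [/\ path adjacent_squares w p, last w p = u
                           & all (fun z => f z != 0) (w :: p)] >].

Lemma cluster_separated f w : separated (cluster f w) f.
Proof.
move=> u u' uu' /asboolP[p [wp pu fp]] Cu'; apply/eqP; apply: contraNT Cu' => fu'.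
apply/asboolP; exists (rcons p u'); split; last by rewrite -rcons_cons all_rcons fu'.
  by rewrite rcons_path wp pu.
by rewrite last_rcons.
Qed.

Lemma cluster_self f w : f w != 0 -> cluster f w w.
Proof. by move=> fw; apply/asboolP; exists [::]; split=> //=; rewrite fw. Qed.

(** An integer function with steps of size at most 1 cannot change sign without taking the value
    0. *)
Lemma cluster_pos f w u :
  (forall u u', adjacent_squares u u' -> `|f u - f u'| <= 1) ->
  0 < f w -> cluster f w u -> 0 < f u.
Proof.
move=> lip fw /asboolP[p [+ <-]].
elim: p w fw => [//|y p IH] w fw /= /andP[/lip wy yp] /and3P[w0 y0 fp].
by apply: IH => //=; [lia|rewrite y0 fp].
Qed.

Lemma eq_cluster f g w : (forall u, (f u == 0) = (g u == 0)) ->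
  cluster f w = cluster g w.
Proof.
move=> fg; apply/funext => u; rewrite /cluster; congr asbool.
apply/propext; split=> -[p [wp pu fp]]; exists p; split=> //;
  by move: fp; congr is_true; apply: eq_all => z; rewrite fg.
Qed.

Section Exchange.
Variables (black : pred (int * int)) (R : {fset int * int}).
Variables (T0 : tilings_type) (v w : int * int).
Hypotheses (black_ch : checkerboard black) (T0_tiling : tiling R T0).

Let X : finType := tilings R.
Let psi := psi black T0 v.
Let hgt (T : X) : int * int -> int := psi (\val T).

Let tilingX (T : X) : tiling R (\val T).
Proof. exact/mem_tilings/valP. Qed.

Lemma psi_east T u : tiling R T ->
  psi T (east u) = psi T u - color_sign black u * (xh T u - xh T0 u).
Proof. by move=> /(psiP v black_ch T0_tiling)[_ /(_ u)[]]. Qed.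

Lemma psi_north T u : tiling R T ->
  psi T (north u) = psi T u + color_sign black u * (xv T u - xv T0 u).
Proof. by move=> /(psiP v black_ch T0_tiling)[_ /(_ u)[]]. Qed.

(** The contributions of [T0] cancel, leaving a difference of two indicators on each edge. *)
Lemma psi_lipschitz (T T' : X) u u' k : adjacent_squares u u' ->
  `|(hgt T u - hgt T' u - k) - (hgt T u' - hgt T' u' - k)| <= 1.
Proof.
have E z : `|(hgt T z - hgt T' z - k) - (hgt T (east z) - hgt T' (east z) - k)| <= 1.
  rewrite /hgt !psi_east //.
  by rewrite /xh /color_sign; case: black; do !case: (_ \in _); lia.
have N z : `|(hgt T z - hgt T' z - k) - (hgt T (north z) - hgt T' (north z) - k)| <= 1.
  rewrite /hgt !psi_north //.
  by rewrite /xv /color_sign; case: black; do !case: (_ \in _); lia.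
case/adjacent_squaresP => -> //.
  by rewrite distrC; have := E (west u); rewrite westK.
by rewrite distrC; have := N (south u); rewrite southK.
Qed.

(** Pairs of tilings with a positive term are matched with pairs with the opposite term by
    exchanging the two tilings on the cluster of [w]. *)
Lemma exchange (S : seq (int * int)) (a b : int * int -> int) (k : int) :
  v \in S -> (forall u, u \in S -> a u <= b u + k) ->
  \sum_(T in cylinder hgt S a) \sum_(T' in cylinder hgt S b)
    (hgt T w - hgt T' w - k) <= 0.
Proof.
move=> vS ab; rewrite pair_big /=.
pose phi (p : X * X) u := hgt p.1 u - hgt p.2 u - k.
pose C p := cluster (phi p) w.
pose g (p : X * X) : X * X := (insubd p.1 (swap (C p) (\val p.1) (\val p.2)),
                               insubd p.2 (swap (C p) (\val p.2) (\val p.1))).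
apply: (@sum_le0_of_sign_reversing _ _ (fun p => phi p w) g) => p /andP[pA pB] pw.
have pA' u : u \in S -> hgt p.1 u = a u.
  by move: pA; rewrite finset.inE => /allP/[apply]/eqP.
have pB' u : u \in S -> hgt p.2 u = b u.
  by move: pB; rewrite finset.inE => /allP/[apply]/eqP.
have CS u : u \in S -> ~~ C p u.
  move=> uS; apply/negP => Cu.
  have := cluster_pos (fun z z' => @psi_lipschitz p.1 p.2 z z' k) pw Cu.
  by rewrite pA' // pB' //; have := ab u uS; lia.
have sep : separated (C p) (phi p) by exact: cluster_separated.
have sep' : separated (C p) (fun u => hgt p.2 u - hgt p.1 u - (- k)).
  rewrite (_ : (fun u => _) = (fun u => - phi p u)); first exact: separated_opp.
  by apply/funext => u; rewrite /phi; ring.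
(* [phi p] is positive on [C p] and nonpositive on [S], so the exchange keeps
   both cylinder conditions and reverses the sign of [phi p w]. *)
have t1 := swap_tiling black_ch T0_tiling (tilingX p.1) (tilingX p.2) sep.
have t2 := swap_tiling black_ch T0_tiling (tilingX p.2) (tilingX p.1) sep'.
have v1 : \val (g p).1 = swap (C p) (\val p.1) (\val p.2).
  by rewrite /g /= insubdK //; exact/mem_tilings.
have v2 : \val (g p).2 = swap (C p) (\val p.2) (\val p.1).
  by rewrite /g /= insubdK //; exact/mem_tilings.
have h1 u : hgt (g p).1 u = if C p u then hgt p.2 u + k else hgt p.1 u.
  by rewrite /hgt v1 /psi (psi_swap black_ch T0_tiling _ _ (CS v vS) sep).
have h2 u : hgt (g p).2 u = if C p u then hgt p.1 u - k else hgt p.2 u.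
  by rewrite /hgt v2 /psi (psi_swap black_ch T0_tiling _ _ (CS v vS) sep').
have phig u : phi (g p) u = if C p u then - phi p u else phi p u.
  by rewrite /phi h1 h2; case: (C p u) => //; ring.
(* The exchange only flips signs, so zero set and cluster are unchanged; hence a second exchange
   restores the pair. *)
have Cg : C (g p) = C p.
  by apply: eq_cluster => u; rewrite phig; case: ifP; rewrite ?oppr_eq0.
split.
- apply/andP; split; rewrite finset.inE; apply/allP => u uS.
    by rewrite h1 (negbTE (CS u uS)) pA'.
  by rewrite h2 (negbTE (CS u uS)) pB'.
- by rewrite phig /C cluster_self // gt_eqF.
- rewrite [LHS]surjective_pairing [RHS]surjective_pairing.
  by congr pair; apply: val_inj; rewrite /g /= Cg !insubdK ?swapK //;
    exact/mem_tilings.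
Qed.

End Exchange.

(** * Height functions *)

Lemma left_of_east s u : left_of s u (east u) = (s == u).
Proof.
rewrite /left_of /next /= !inE !pair_eqE /=.
by do !(case: ifP => /=; rewrite ?pair_eqE /=); lia.
Qed.

Lemma left_of_west s u : left_of s (east u) u = (s == south u).
Proof.
rewrite /left_of /next /= !inE !pair_eqE /=.
by do !(case: ifP => /=; rewrite ?pair_eqE /=); lia.
Qed.

Lemma left_of_north s u : left_of s u (north u) = (s == west u).
Proof.
rewrite /left_of /next /= !inE !pair_eqE /=.
by do !(case: ifP => /=; rewrite ?pair_eqE /=); lia.
Qed.

Lemma left_of_south s u : left_of s (north u) u = (s == u).
Proof.
rewrite /left_of /next /= !inE !pair_eqE /=.
by do !(case: ifP => /=; rewrite ?pair_eqE /=); lia.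
Qed.

Lemma left_of_lattice_edge s u u' : left_of s u u' ->
  [\/ u' = east u, u = east u', u' = north u | u = north u'].
Proof.
move=> sl; have : adjacent_squares u u'.
  move: sl; rewrite /left_of /next /adjacent_squares /= !inE !pair_eqE /=.
  by do !(case: ifP => /=; rewrite ?pair_eqE /=); lia.
move=> /adjacent_squaresP[->|->|->|->].
- exact: Or41.
- by apply: Or42; rewrite westK.
- exact: Or43.
- by apply: Or44; rewrite southK.
Qed.

Variant region_edge (R : {fset int * int}) : int * int -> int * int -> Prop :=
| EastEdge x of (x \in R) || (south x \in R) : region_edge R x (east x)
| WestEdge x of (x \in R) || (south x \in R) : region_edge R (east x) x
| NorthEdge x of (x \in R) || (west x \in R) : region_edge R x (north x)
| SouthEdge x of (x \in R) || (west x \in R) : region_edge R (north x) x.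

Definition left_ofE := (left_of_east, left_of_west, left_of_north, left_of_south).

Lemma adjacentP R u u' : reflect (region_edge R u u') (adjacent R u u').
Proof.
have edge s x : edge_of s x (east x) = (s == x) || (s == south x).
  by rewrite /edge_of !left_ofE.
have edge' s x : edge_of s (east x) x = (s == south x) || (s == x).
  by rewrite /edge_of !left_ofE.
have edgeN s x : edge_of s x (north x) = (s == west x) || (s == x).
  by rewrite /edge_of !left_ofE.
have edgeN' s x : edge_of s (north x) x = (s == x) || (s == west x).
  by rewrite /edge_of !left_ofE.
have adjI s : s \in R -> edge_of s u u' -> adjacent R u u'.
  by move=> sR su; apply/existsP; exists [` sR]%fset.
apply: (iffP idP) => [/existsP[[s sR] /= su]|].
  have : [\/ u' = east u, u = east u', u' = north u | u = north u'].
    case/orP: su => /left_of_lattice_edge //.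
    by case; [exact: Or42 | exact: Or41 | exact: Or44 | exact: Or43].
  by case=> e; subst; constructor; move: su;
    rewrite ?edge ?edge' ?edgeN ?edgeN' => /orP[]/eqP<-; rewrite sR ?orbT.
by move: adjI => /[swap] -[] x + adjI => /orP[xR|xR]; apply: (adjI _ xR);
  rewrite ?edge ?edge' ?edgeN ?edgeN' eqxx ?orbT.
Qed.

Section HeightIncrements.
Variables (black : pred (int * int)) (R : {fset int * int}).
Hypothesis black_ch : checkerboard black.
Implicit Types (T : tilings_type) (h : int * int -> int) (u v : int * int).

(** The factor [1 - 4 * x] is 1, or -3 across a domino. The square left of the eastward edge is [u],
    that left of the northward edge is [west u], of opposite color; hence the opposite signs. *)
Definition height_increments T h := forall u,
  ((u \in R) || (south u \in R) ->
     h (east u) = h u + color_sign black u * (1 - 4 * xh T u)) /\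
  ((u \in R) || (west u \in R) ->
     h (north u) = h u - color_sign black u * (1 - 4 * xv T u)).

Lemma black_south u : black (south u) = ~~ black u.
Proof. by apply: black_ch; apply/adjacent_squaresP/Or43; rewrite southK. Qed.

Lemma black_west u : black (west u) = ~~ black u.
Proof. by apply: black_ch; apply/adjacent_squaresP/Or41; rewrite westK. Qed.

Lemma increments_of_height T h :
  height_function black R h -> arises_from R T h -> height_increments T h.
Proof.
move=> hh hT u.
(* A domino determines its bisected edge up to direction, so the edge provided by [arises_from] is
   the one at [x]. *)
have hdomT x : hdom x \in T -> `|h x - h (east x)| = 3.
  move=> /hT[y [y' [s [t [_ y3 + + e]]]]] => sy; move: (sy) => /left_of_lattice_edge.
  case=> yy; move: sy y3 e; rewrite yy !left_ofE => /eqP-> y3 e /eqP te;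
    rewrite te in e.
  - by rewrite (hdom_inj e).
  - by rewrite (@hdom_inj x y') 1?distrC // e /hdom fsetUC.
  - by have /eqP := hdom_neq_vdom x y; rewrite e.
  - by have /eqP := hdom_neq_vdom x y'; rewrite e /vdom fsetUC.
have vdomT x : vdom x \in T -> `|h x - h (north x)| = 3.
  move=> /hT[y [y' [s [t [_ y3 + + e]]]]] => sy; move: (sy) => /left_of_lattice_edge.
  case=> yy; move: sy y3 e; rewrite yy !left_ofE => /eqP-> y3 e /eqP te;
    rewrite te in e.
  - by have /eqP := hdom_neq_vdom y x; rewrite e.
  - by have /eqP := hdom_neq_vdom y' x; rewrite e /hdom fsetUC.
  - by rewrite (vdom_inj e).
  - by rewrite (@vdom_inj x y') 1?distrC // e /vdom fsetUC.
split=> uR.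
  have a1 : adjacent R u (east u) by apply/adjacentP/EastEdge.
  have a2 : adjacent R (east u) u by apply/adjacentP/WestEdge.
  have T3 : `|h u - h (east u)| = 3 -> hdom u \in T.
    by move=> d3; apply/hT; exists u, (east u), u, (south u); rewrite !left_ofE.
  have := hdomT u; rewrite /xh /color_sign; case: (boolP (black u)) => bu.
    have [_ []] := hh _ _ a1; first by exists u; rewrite ?left_ofE.
      by move=> e; rewrite e in T3 *; case: (hdom u \in T) T3 => T3 T3'; lia.
    by move=> e; rewrite e in T3 *; case: (hdom u \in T) T3 => T3 T3'; lia.
  (* For white [u] the black square [south u] lies to the left of the reversed edge. *)
  have [_ []] := hh _ _ a2.
  - by exists (south u); rewrite ?left_ofE // black_south.
  - by move=> e; rewrite e in T3 *; case: (hdom u \in T) T3 => T3 T3'; lia.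
  - by move=> e; rewrite e in T3 *; case: (hdom u \in T) T3 => T3 T3'; lia.
have a1 : adjacent R u (north u) by apply/adjacentP/NorthEdge.
have a2 : adjacent R (north u) u by apply/adjacentP/SouthEdge.
have T3 : `|h u - h (north u)| = 3 -> vdom u \in T.
  by move=> d3; apply/hT; exists u, (north u), (west u), u; rewrite !left_ofE.
have := vdomT u; rewrite /xv /color_sign; case: (boolP (black u)) => bu.
  have [_ []] := hh _ _ a2; first by exists u; rewrite ?left_ofE.
    by move=> e; rewrite e in T3 *; case: (vdom u \in T) T3 => T3 T3'; lia.
  by move=> e; rewrite e in T3 *; case: (vdom u \in T) T3 => T3 T3'; lia.
have [_ []] := hh _ _ a1.
- by exists (west u); rewrite ?left_ofE // black_west.
- by move=> e; rewrite e in T3 *; case: (vdom u \in T) T3 => T3 T3'; lia.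
- by move=> e; rewrite e in T3 *; case: (vdom u \in T) T3 => T3 T3'; lia.
Qed.

Lemma height_of_increments T h : tiling R T -> height_increments T h ->
  height_function black R h /\ arises_from R T h.
Proof.
move=> [Td _ TR] hT.
have TsubR d s : d \in T -> s \in d -> s \in R.
  by move=> dT sd; rewrite -TR; apply/mem_fcover; exists d.
have hdom_in x : hdom x \in T -> x \in R /\ south x \in R.
  by move=> xT; split; apply: TsubR xT _; rewrite mem_hdom ?southK eqxx ?orbT.
have vdom_in x : vdom x \in T -> x \in R /\ west x \in R.
  by move=> xT; split; apply: TsubR xT _; rewrite mem_vdom ?westK eqxx ?orbT.
split.
  move=> _ _ /adjacentP[] x xR; have [hE hN] := hT x.
  - have {hN} := hE xR => {}hE; split.
      move=> [s [t [sR + tR]]]; rewrite /edge_of !left_ofE => es et.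
      suff xT : hdom x \notin T.
        by move: hE; rewrite /xh (negbTE xT) /color_sign; case: black; lia.
      (* A domino bisected by a boundary edge would have a square outside [R]. *)
      apply: contra tR => /hdom_in[xR1 xR2].
      by case/orP: et => /eqP->.
    move=> [s bs]; rewrite left_ofE => /eqP e; move: hE.
    by rewrite -e /color_sign bs /xh; case: (_ \in T); lia.
  - have {hN} := hE xR => {}hE; split.
      move=> [s [t [sR + tR]]]; rewrite /edge_of !left_ofE => es et.
      suff xT : hdom x \notin T.
        by move: hE; rewrite /xh (negbTE xT) /color_sign; case: black; lia.
      apply: contra tR => /hdom_in[xR1 xR2].
      by case/orP: et => /eqP->.
    move=> [s bs]; rewrite left_ofE => /eqP e; move: hE bs.
    by rewrite e black_south /color_sign /xh; case: black; case: (_ \in T) => //; lia.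
  - have {hE} := hN xR => {}hN; split.
      move=> [s [t [sR + tR]]]; rewrite /edge_of !left_ofE => es et.
      suff xT : vdom x \notin T.
        by move: hN; rewrite /xv (negbTE xT) /color_sign; case: black; lia.
      apply: contra tR => /vdom_in[xR1 xR2].
      by case/orP: et => /eqP->.
    move=> [s bs]; rewrite left_ofE => /eqP e; move: hN bs.
    by rewrite e black_west /color_sign /xv; case: black; case: (_ \in T) => //; lia.
  - have {hE} := hN xR => {}hN; split.
      move=> [s [t [sR + tR]]]; rewrite /edge_of !left_ofE => es et.
      suff xT : vdom x \notin T.
        by move: hN; rewrite /xv (negbTE xT) /color_sign; case: black; lia.
      apply: contra tR => /vdom_in[xR1 xR2].
      by case/orP: et => /eqP->.
    move=> [s bs]; rewrite left_ofE => /eqP e; move: hN.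
    by rewrite -e /color_sign bs /xv; case: (_ \in T); lia.
move=> d; split=> [dT|].
  have /dominoP[x [e|e]] := Td d dT; subst d; have [hE hN] := hT x.
    have [xR _] := hdom_in _ dT; have {}hE := hE (introT orP (or_introl xR)).
    exists x, (east x), x, (south x); rewrite !left_ofE !eqxx; split=> //.
      by apply/adjacentP/EastEdge; rewrite xR.
    by move: hE; rewrite /xh dT /color_sign; case: black; lia.
  have [xR _] := vdom_in _ dT; have {}hN := hN (introT orP (or_introl xR)).
  exists x, (north x), (west x), x; rewrite !left_ofE !eqxx; split=> //.
    by apply/adjacentP/NorthEdge; rewrite xR.
  by move: hN; rewrite /xv dT /color_sign; case: black; lia.
have hdomT x : (x \in R) || (south x \in R) -> `|h x - h (east x)| = 3 -> hdom x \in T.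
  move=> xR; have [/(_ xR)-> _] := hT x; rewrite /xh /color_sign.
  by case: (_ \in T) => //; case: black; lia.
have vdomT x : (x \in R) || (west x \in R) -> `|h x - h (north x)| = 3 -> vdom x \in T.
  move=> xR; have [_ /(_ xR)->] := hT x; rewrite /xv /color_sign.
  by case: (_ \in T) => //; case: black; lia.
move=> [u [u' [s [t [/adjacentP[] x xR]]]]]; rewrite !left_ofE => u3 /eqP-> /eqP-> ->.
- exact: hdomT.
- by rewrite fsetUC; apply: hdomT => //; rewrite distrC.
- exact: vdomT.
- by rewrite fsetUC; apply: vdomT => //; rewrite distrC.
Qed.

Definition has_height T := exists h, height_function black R h /\ arises_from R T h.

Lemma height_incrementsP T : has_height T -> height_increments T (height black R T).
Proof. by move=> /(xgetPex (fun=> 0))[]; exact: increments_of_height. Qed.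

(** Adding four times the potential of [T] replaces the indicators of [T0] by those of [T] in the
    increments. *)
Lemma has_height_transfer T0 v T : tiling R T0 -> tiling R T ->
  has_height T0 -> has_height T.
Proof.
move=> tT0 tT /height_incrementsP hT0; have [_ pT] := psiP v black_ch tT0 tT.
exists (fun u => height black R T0 u + 4 * psi black T0 v T u).
apply: height_of_increments => // u; have [hE hN] := hT0 u; have [pE pN] := pT u.
by split=> uR; rewrite ?hE ?hN // ?pE ?pN; ring.
Qed.

(** Sum over the edges of the path: heights are constrained only along edges of [R], so the
    endpoints are compared through a path in [R]. *)
Lemma height_differ T0 v T u p : tiling R T0 -> tiling R T -> has_height T0 ->
  path (adjacent R) u p ->
  height black R T u - height black R T (last u p) =
  height black R T0 u - height black R T0 (last u p)
    + 4 * (psi black T0 v T u - psi black T0 v T (last u p)).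
Proof.
move=> tT0 tT T0h; have /height_incrementsP hT := has_height_transfer v tT0 tT T0h.
have /height_incrementsP hT0 := T0h; have [_ pT] := psiP v black_ch tT0 tT.
elim: p u => [|y p IH] u /=; first by rewrite !subrr.
move=> /andP[uy /IH {}IH]; have {uy} : height black R T u - height black R T y =
    height black R T0 u - height black R T0 y +
    4 * (psi black T0 v T u - psi black T0 v T y).
  case/adjacentP: uy => x xR; have [hE hN] := hT x; have [hE0 hN0] := hT0 x;
    have [pE pN] := pT x.
  - by rewrite hE // hE0 // pE; ring.
  - by rewrite hE // hE0 // pE; ring.
  - by rewrite hN // hN0 // pN; ring.
  - by rewrite hN // hN0 // pN; ring.
by lia.
Qed.

End HeightIncrements.

(** * Exposure along a path in [R] and the concentration bound *)

Lemma adjacent_two_valued_step black R T0 v u u' : checkerboard black ->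
  tiling R T0 -> adjacent R u u' ->
  two_valued_step (fun T : tilings R => psi black T0 v (\val T)) u u'.
Proof.
move=> bch tT0 uu'; apply/asboolP.
have pE (T : tilings R) z :=
  psi_east v bch tT0 z (elimT (mem_tilings _ _) (valP T)).
have pN (T : tilings R) z :=
  psi_north v bch tT0 z (elimT (mem_tilings _ _) (valP T)).
case/adjacentP: uu' => x _.
- exists (if black x then xh T0 x - 1 else - xh T0 x) => T; rewrite pE /color_sign /xh.
  by case: (black x); case: (_ \in val T); lia.
- exists (if black x then - xh T0 x else xh T0 x - 1) => T; rewrite pE /color_sign /xh.
  by case: (black x); case: (_ \in val T); lia.
- exists (if black x then - xv T0 x else xv T0 x - 1) => T; rewrite pN /color_sign /xv.
  by case: (black x); case: (_ \in val T); lia.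
- exists (if black x then xv T0 x - 1 else - xv T0 x) => T; rewrite pN /color_sign /xv.
  by case: (black x); case: (_ \in val T); lia.
Qed.

Section UniformAsFinite.
Variables (K : realType) (R : {fset int * int}).

Lemma tiling_meanE (f : tilings_type -> K) :
  tiling_mean R f = (\sum_(T : tilings R) f (\val T)) / #|{: tilings R}|%:R.
Proof. by rewrite /tiling_mean big_seq_fsetE cardfE. Qed.

Lemma tiling_probE (E : pred tilings_type) :
  tiling_prob K R E =
    #|[set T : tilings R | E (\val T)]%SET|%:R / #|{: tilings R}|%:R.
Proof.
rewrite /tiling_prob -cardfE; congr (_%:R / _).
rewrite card_fset_sum1 -big_fset_condE /= big_seq_fsetE /= sum1dep_card.
by rewrite finset.cardsE.
Qed.

End UniformAsFinite.

Theorem proposition22 (K : realType) (black : pred square)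
    (R : {fset square}) (v w : vertex) (p : seq vertex) (m : nat) (c : K) :
  checkerboard black ->
  (exists T, tiling R T) ->
  simply_connected K (region_set K R) ->
  (region_set K R)° (vertex_point K v) ->
  (region_set K R)° (vertex_point K w) ->
  path (adjacent R) v p -> last v p = w -> size (v :: p) = m ->
  0 < c ->
  let D := fun T => (height black R T v - height black R T w)%:~R : K in
  tiling_prob K R (fun T => c * Num.sqrt m%:R < `|D T - tiling_mean R D|)
    < 2 * expR (- (c ^+ 2 / 32)).
Proof.
move=> bch [T1 tT1] _ _ _ vp lw sm c0.
pose D T : K := (height black R T v - height black R T w)%:~R.
change (tiling_prob K R (fun T => c * Num.sqrt m%:R < `|D T - tiling_mean R D|)
  < 2 * expR (- (c ^+ 2 / 32))).
have m0 : (0 < m)%N by rewrite -sm.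
have sm0 : 0 < Num.sqrt (m%:R : K) by rewrite sqrtr_gt0 ltr0n.
have X0 : (0 < #|{: tilings R}|)%N.
  by apply/card_gt0P; exists [` introT (mem_tilings R T1) tT1]%fset.
have tX (T : tilings R) : tiling R (\val T) by exact/mem_tilings/valP.
(* Without height functions [height] is constantly [0], and so is [D]. *)
have [[T0 tT0 hT0]|noh] := pselect (exists2 T, tiling R T & has_height black R T);
  last first.
  have D0 T : tiling R T -> D T = 0.
    move=> tT; rewrite /D /height.
    case: xgetP => [h _ hT|_]; last by rewrite subrr.
    by case: noh; exists T => //; exists h.
  rewrite tiling_probE tiling_meanE big1 => [|T _]; last exact: D0.
  rewrite (_ : [set T | _]%SET = finset.set0) ?cards0 ?mul0r ?mulr_gt0 ?expR_gt0//.
  apply/setP => T; rewrite !finset.inE D0 // ?mul0r subrr normr0.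
  by apply/negbTE; rewrite -leNgt mulr_ge0 // ltW.
pose val (T : tilings R) := psi black T0 v (\val T).
pose a : K := (height black R T0 v - height black R T0 w)%:~R.
(* The potential vanishes at [v], so only its value at [w] remains. *)
have DE (T : tilings R) : D (\val T) = a - 4 * (val T w)%:~R.
  have [pv _] := psiP v bch tT0 (tX T).
  rewrite /D -lw (height_differ bch v tT0 (tX T) hT0 vp) pv lw sub0r.
  by rewrite /a mulrN rmorphB /= rmorphM.
have meanE : tiling_mean R D = a - 4 * mean K val w finset.setT.
  rewrite tiling_meanE (eq_bigr _ (fun T _ => DE T)) sumrB sumr_const -mulr_sumr.
  rewrite /mean mulrBl -(mulr_natr a) mulfK ?pnatr_eq0 -?lt0n// cardsT mulrA.
  congr (_ - _ * _ / _); apply: eq_bigl => T; by rewrite finset.inE.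
rewrite tiling_probE meanE ltr_pdivrMr ?ltr0n // mulrAC.
(* The factor 4 between heights and potentials turns the deviation into [t = c * Num.sqrt m / 4],
   and [t ^+ 2 / (2 * m)] is [c ^+ 2 / 32]. *)
have -> : c ^+ 2 / 32 = (c * Num.sqrt m%:R / 4) ^+ 2 / (2 * m%:R).
  rewrite !exprMn sqr_sqrtr ?ler0n//; field.
  by rewrite pnatr_eq0 -lt0n.
have -> : [set T : tilings R | c * Num.sqrt m%:R <
      `|D (\val T) - (a - 4 * mean K val w finset.setT)|]%SET =
    [set T | c * Num.sqrt m%:R / 4 <
      `|(val T w)%:~R - mean K val w finset.setT|]%SET.
  apply/setP => T; rewrite !finset.inE DE ltr_pdivrMr //.
  rewrite (_ : _ - _ - _ = - (((val T w)%:~R - mean K val w finset.setT) * 4)).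
    by rewrite normrN normrM (ger0_norm (_ : 0 <= 4)).
  by ring.
apply: (@azuma_tail K _ _ val v w _ _ p m) => //.
- by move=> S b b' k; apply: exchange.
- by move=> T; have [] := psiP v bch tT0 (tX T).
- by apply: sub_path vp => x y; exact: adjacent_two_valued_step.
(* [m] counts vertices including [v], so [p] has one step fewer. *)
- by rewrite -sm.
- by rewrite divr_gt0 ?mulr_gt0.
Qed.
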